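(* Let $X,X_1,X_2,\dots$ be i.i.d. positive random variables, let $p\ge 2$ be an integer, and set $$T_n=\frac{X_1^2+\dots+X_n^2}{X_1+\dots+X_n},\qquad M_n=\max_{1\le i\le n}X_i,\qquad R_n^{(p)}=\frac{T_n^pM_n^2}{X_1+\dots+X_n}.$$ If $\mathbb{P}(X\ge x)=O(x^{-p-7/2})$ as $x\to+\infty$, then $\mathbb{E}R_n^{(p)}=O(n^{-1/2})$. When $p>8$ and $\mathbb{E}X^{p+4}<\infty$, one has $\mathbb{E}R_n^{(p)}=O(n^{-(p-2)/(p+4)})$. Moreover, if $\mathbb{E}e^{\varepsilon X}<\infty$ for some $\varepsilon>0$, then $\mathbb{E}R_n^{(p)}=O\left(\frac{(\log n)^2}{n}\right)$. *)

(* Defs.v *)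
From HB Require Import structures.
From mathcomp Require Import all_boot all_order all_algebra.
From mathcomp Require Import all_classical all_reals all_analysis.
Set Implicit Arguments. Unset Strict Implicit. Unset Printing Implicit Defensive.
Import Order.TTheory GRing.Theory Num.Def Num.Theory.
Import numFieldNormedType.Exports.
Local Open Scope classical_set_scope.
Local Open Scope ring_scope.

Definition mutually_independent d (T : measurableType d) (R : realType)
  (P : probability T R) (X : nat -> {RV P >-> R}) : Prop :=
  forall (s : seq nat) (B : nat -> set R), uniq s ->
    (forall i, measurable (B i)) ->
    P (\bigcap_(i in [set j | j \in s]) (X i @^-1` B i)) =
    (\prod_(i <- s) P (X i @^-1` B i))%E.

Definition identically_distributed d (T : measurableType d) (R : realType)
  (P : probability T R) (X : nat -> {RV P >-> R}) : Prop :=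
  forall i (B : set R), measurable B -> P (X i @^-1` B) = P (X 0%N @^-1` B).

Definition iid d (T : measurableType d) (R : realType)
  (P : probability T R) (X : nat -> {RV P >-> R}) : Prop :=
  mutually_independent X /\ identically_distributed X.

(* With X_1, ..., X_n represented by X 0, ..., X (n-1). *)
Definition Sn {T : Type} {R : realType} (X : nat -> T -> R) (n : nat) (w : T) : R :=
  \sum_(i < n) X i w.

Definition Tn {T : Type} {R : realType} (X : nat -> T -> R) (n : nat) (w : T) : R :=
  (\sum_(i < n) X i w ^+ 2) / Sn X n w.

Definition Mn {T : Type} {R : realType} (X : nat -> T -> R) (n : nat) (w : T) : R :=
  \big[Num.max/0]_(i < n) X i w.

Definition Rn {T : Type} {R : realType} (p : nat) (X : nat -> T -> R) (n : nat) (w : T) : R :=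
  Tn X n w ^+ p * Mn X n w ^+ 2 / Sn X n w.

(* Main.v *)
(* Let S be the sum, M the maximum and Q the sum of squares of X_1, ..., X_n.
   Chernoff bounds give S >= c n, and Q <= K n on the event M <= L, outside of
   events of probability at most exp(-n) and exp(-n / L^2): both only need the
   product formula for finite sums of indicators, in the second case because
   X^2 is dominated by \sum_(k >= 0) 1_(k <= X^2).  On the main event
   T = Q / S <= K / c, so E R is at most a constant times E M^2 / n.  When
   M > L, the inequality T <= M yields R <= M^(p+2) / (c n), and a union bound
   reduces this contribution to E(X^(p+2); X > L).  The three rates come from
   the choices L = n^(1/3), L = n^((p-2)/(2(p+4))) and L = (2/eps) log n. *)
Require Import Defs.
From HB Require Import structures.
From mathcomp Require Import all_boot all_order all_algebra.
From mathcomp Require Import all_classical all_reals all_analysis.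
From mathcomp Require Import measurable_realfun.
From mathcomp Require Import ring lra.
Import Order.TTheory GRing.Theory Num.Def Num.Theory.
Import numFieldNormedType.Exports.
Local Open Scope classical_set_scope.
Local Open Scope ring_scope.

(** * Elementary inequalities for exponentials, counting and powers *)

Section real_inequalities.
Context {R : realType}.

(** From [expR (- x) >= 1 - x] one gets [expR x * (1 - x) <= 1], while [(1 - x) * (1 + 2 * x) >= 1]
    on this interval because [x * (1 - 2 * x) >= 0]. *)
Lemma expR_le_1D2x (x : R) : 0 <= x <= 1 / 2 -> expR x <= 1 + 2 * x.
Proof.
move=> x12; have := expR_ge1Dx (- x); rewrite expRN => h.
have e0 := expR_gt0 x.
have : 1 - x <= (expR x)^-1 by [].
rewrite -(ler_pM2r e0) mulVf ?gt_eqF// => h2.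
nra.
Qed.

(** With [count_nat_ge], this replaces a real number by a finite sum of indicators at the cost of an
    additive 1. Applied to the squares [X i w ^+ 2], it brings them within reach of the product
    formula for indicators. *)
Lemma count_nat_le (y : R) (N : nat) : 0 <= y ->
  \sum_(k < N) (k%:R <= y)%R%:R <= y + 1.
Proof.
move=> y0; elim: N => [|N IH]; first by rewrite big_ord0 addr_ge0.
rewrite big_ord_recr/=; case: (leP N%:R y) => [Ny|_]; last by rewrite addr0.
rewrite lerD//; apply: le_trans Ny.
rewrite -[in leRHS](card_ord N) -sumr_const; apply: ler_sum => i _.
by rewrite lern1 leq_b1.
Qed.

Lemma count_nat_ge (y : R) (N : nat) : 0 <= y -> y <= N%:R ->
  y <= \sum_(k < N) (k%:R <= y)%R%:R.
Proof.
(* Replacing [y] by [min y N] removes the hypothesis [y <= N], which would not survive the induction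
   on [N]. *)
move=> y0 yN; rewrite -[leLHS](min_idPl yN) {yN}.
elim: N => [|N IH]; first by rewrite big_ord0 ge_min lexx orbT.
rewrite big_ord_recr/=; case: (leP N%:R y) IH => [Ny|yN] IH.
  by rewrite ge_min -natr1; apply/orP; right; rewrite lerD2r.
rewrite addr0; apply: le_trans IH.
by rewrite ge_min lexx.
Qed.

Lemma exprn_le_fact_expR (x : R) (m : nat) : 0 <= x -> x ^+ m <= m`!%:R * expR x.
Proof.
case: m => [|m] x0.
  by rewrite expr0 fact0 mul1r (le_trans _ (expR_ge1Dx x))// lerDl.
have := expR_ge1Dxn m x0; rewrite -ler_pdivrMl ?ltr0n ?fact_gt0//.
by rewrite mulrC; apply: le_trans; rewrite lerDr.
Qed.

(* With [L] well below [sqrt n], the exponential beats every power of [L]. *)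
Lemma exprn_mul_expR_bounded (k : nat) (a l : R) : 0 < a -> l < 1 / 2 ->
  exists2 D : R, 0 <= D & forall (n : nat) (L : R), (0 < n)%N -> 0 < L ->
    L <= a * n%:R `^ l -> L ^+ k * expR (- (n%:R / L ^+ 2)) <= D.
Proof.
move=> a0 l2.
have q0 : 0 < 1 - 2 * l by lra.
(* This [m] makes [n ^ (l k)] at most [(n ^ (1 - 2 l)) ^ m]. So [L ^+ k] is bounded by a multiple of
   [y ^+ m], with [y <= n / L ^ 2] below, and [expR y] absorbs [y ^+ m] at the cost of [m!]. *)
pose m := (truncn (l * k%:R / (1 - 2 * l))).+1.
have hm : l * k%:R <= (1 - 2 * l) * m%:R.
  by rewrite [leRHS]mulrC -ler_pdivrMr// ltW// truncnS_gt.
exists (a ^+ k * (a ^+ 2) ^+ m * m`!%:R).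
  by rewrite !mulr_ge0// !exprn_ge0// ltW.
move=> n L n0 L0 La.
have n1 : 1 <= n%:R :> R by rewrite ler1n.
have nl0 s : 0 < (n%:R : R) `^ s by rewrite powR_gt0// ltr0n.
set y := n%:R `^ (1 - 2 * l) / a ^+ 2.
have y0 : 0 <= y by rewrite divr_ge0// ?exprn_ge0 ?ltW.
have yn : y <= n%:R / L ^+ 2.
  have L2 : L ^+ 2 <= a ^+ 2 * n%:R `^ (2 * l).
    rewrite [2 * l]mulrC powRrM powR_mulrn ?powR_ge0// -exprMn.
    by rewrite lerXn2r// nnegrE ?mulr_ge0 ?ltW.
  rewrite ler_pdivlMr ?exprn_gt0//.
  apply: (@le_trans _ _ (y * (a ^+ 2 * n%:R `^ (2 * l)))); first by rewrite ler_wpM2l.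
  rewrite /y mulrA divfK ?gt_eqF ?exprn_gt0// -powRD; last by rewrite pnatr_eq0 -lt0n n0 implybT.
  by rewrite subrK powRr1.
have Lk : L ^+ k <= a ^+ k * ((a ^+ 2) ^+ m * y ^+ m).
  apply: (@le_trans _ _ ((a * n%:R `^ l) ^+ k)).
    by rewrite lerXn2r// nnegrE ?mulr_ge0 ?ltW.
  rewrite exprMn ler_wpM2l ?exprn_ge0 ?(ltW a0)//.
  rewrite -exprMn /y mulrC divfK ?gt_eqF ?exprn_gt0//.
  by rewrite -!powR_mulrn ?powR_ge0// -!powRrM ler_powR.
rewrite expRN ler_pdivrMr ?expR_gt0//.
apply: (le_trans Lk); rewrite -!mulrA !ler_wpM2l ?exprn_ge0 ?(ltW a0)//.
apply: (le_trans (exprn_le_fact_expR y m y0)).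
by rewrite ler_wpM2l// ler_expR.
Qed.

Lemma measurable_exprn_indic_gt k (L : R) :
  measurable_fun setT (fun x : R => x ^+ k * \1_`]L, +oo[ x).
Proof. by apply: measurable_funM => //; exact: measurable_indic. Qed.

Lemma exprn_indic_gt_ge0 k (L x : R) : 0 <= L -> 0 <= x ^+ k * \1_`]L, +oo[ x.
Proof.
move=> L0; rewrite indicE; have [/set_mem/=|_] := boolP (x \in _).
  by rewrite in_itv/= andbT mulr1 => Lx; rewrite exprn_ge0// (le_trans L0)// ltW.
by rewrite mulr0.
Qed.
End real_inequalities.

(** * Integrals of functions of independent, identically distributed variables *)

Section integrals_of_iid.
Context {d : measure_display} {T : measurableType d} {R : realType}.
Context {P : probability T R} {X : nat -> {RV P >-> R}}.

Lemma integral_RV_comp (i : nat) (f : R -> R) :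
  identically_distributed X -> measurable_fun setT f -> (forall x, 0 <= f x) ->
  (\int[P]_w (f (X i w))%:E = \int[P]_w (f (X 0%N w))%:E)%E.
Proof.
move=> idX mf f0.
have push j : (\int[P]_w (f (X j w))%:E =
    \int[distribution P (X j)]_(x in setT) (f x)%:E)%E.
  rewrite /distribution ge0_integral_pushforward//=.
  - exact/measurable_EFinP.
  - by move=> y _; rewrite lee_fin.
rewrite !push; apply: eq_measure_integral => A mA _.
exact: idX.
Qed.

(** Distributing the product over the sums gives one term for each choice function
    [f : 'I_n -> 'I_m]. That term is a constant times the indicator of an intersection of
    independent events, so the definition of independence applies directly. *)
Lemma integral_prod_sum_indic (n m : nat) (b : 'I_m -> R) (B : 'I_m -> set R) :
  iid X -> (forall k, 0 <= b k) -> (forall k, measurable (B k)) ->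
  (\int[P]_w (\prod_(i < n) \sum_(k < m) b k * \1_(B k) (X i w))%:E =
   (\int[P]_w (\sum_(k < m) b k * \1_(B k) (X 0%N w))%:E) ^+ n)%E.
Proof.
move=> [indX idX] b0 mB.
have mX i (A : set R) : measurable A -> measurable (X i @^-1` A).
  by move=> mA; rewrite -[X in measurable X]setTI; exact: measurable_funP.
have int1 : (\int[P]_w (\sum_(k < m) b k * \1_(B k) (X 0%N w))%:E =
    \sum_(k < m) (b k)%:E * P (X 0%N @^-1` B k))%E.
  rewrite (eq_integral (fun w => \sum_(k < m) (b k * \1_(B k) (X 0%N w))%:E))%E;
    last by move=> w _; rewrite sumEFin.
  rewrite ge0_integral_sum//.
  - apply: eq_bigr => k _.
    under eq_integral do rewrite EFinM.
    rewrite ge0_integralZl_EFin//.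
    + by rewrite (integral_indic _ _ (mX _ _ (mB k)))// setIT.
    + apply/measurable_EFinP; apply: measurable_indic; exact: mX.
  - move=> k; apply/measurable_EFinP; apply: measurable_funM => //.
    apply: measurable_indic; exact: mX.
  - by move=> k w _; rewrite lee_fin mulr_ge0.
pose q k := fine (P (X 0%N @^-1` B k)).
have qE k : P (X 0%N @^-1` B k) = (q k)%:E.
  by rewrite fineK// fin_num_measure//; exact: mX.
have -> : (\int[P]_w (\sum_(k < m) b k * \1_(B k) (X 0%N w))%:E =
    (\sum_(k < m) b k * q k)%:E)%E.
  by rewrite int1 -sumEFin; apply: eq_bigr => k _; rewrite qE EFinM.
rewrite -EFin_expe -[X in _ ^+ X]card_ord -prodr_const bigA_distr_bigA/= -sumEFin.
under eq_integral do rewrite bigA_distr_bigA/= -sumEFin.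
(* Independence is stated for families of sets indexed by [nat], so [B (f i)] is extended by [setT]
   beyond [n]. *)
pose pre (f : {ffun 'I_n -> 'I_m}) (j : nat) : set R :=
  if insub j is Some i then B (f i) else setT.
have preE f (i : 'I_n) : pre f i = B (f i) by rewrite /pre valK.
pose A f := \bigcap_(i in [set j | j \in index_iota 0 n]) (X i @^-1` pre f i).
have mpre f j : measurable (pre f j) by rewrite /pre; case: insub.
have mA f : measurable (A f).
  apply: fin_bigcap_measurable; first exact: finite_seq.
  by move=> i _; exact: mX.
have prodE (f : {ffun 'I_n -> 'I_m}) w :
    \prod_(i < n) (b (f i) * \1_(B (f i)) (X i w)) =
    \prod_(i < n) b (f i) * \1_(A f) w.
  rewrite big_split/=; congr (_ * _).
  have [/set_mem Aw|/negP Aw] := boolP (w \in A f).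
    rewrite [RHS]indicE mem_set// big1// => i _.
    have := Aw i; rewrite /= mem_index_iota ltn_ord preE => /(_ isT) Bw.
    by rewrite indicE mem_set.
  rewrite [RHS]indicE (negbTE (introN idP Aw)).
  apply/eqP; rewrite prodf_seq_eq0; apply: contra_notT Aw => /hasPn Bw.
  apply/mem_set => j /=; rewrite mem_index_iota /= => jn.
  have := Bw (Ordinal jn) (mem_index_enum _).
  rewrite /= indicE pnatr_eq0 eqb0 negbK => /set_mem.
  by rewrite -(preE f (Ordinal jn)).
under eq_integral do under eq_bigr do rewrite prodE.
have PA f : P (A f) = (\prod_(i < n) q (f i))%:E.
  rewrite /A indX//; last exact: iota_uniq.
  rewrite big_mkord -prodEFin; apply: eq_bigr => i _.
  by rewrite idX// preE qE.
rewrite ge0_integral_sum//.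
- apply: eq_bigr => f _; under eq_integral do rewrite EFinM.
  rewrite ge0_integralZl_EFin//.
  + by rewrite (integral_indic _ _ (mA f))// setIT big_split/= EFinM PA.
  + by apply/measurable_EFinP; exact: measurable_indic.
  + exact: prodr_ge0.
- by move=> f; apply/measurable_EFinP; apply: measurable_funM.
- by move=> f w _; rewrite lee_fin mulr_ge0// prodr_ge0.
Qed.
End integrals_of_iid.

(** * Pointwise bounds on the sum, the maximum and the ratios *)

Section pointwise.
Context {T : Type} {R : realType}.
Implicit Types (X : nat -> T -> R) (w : T).

Lemma Mn_ge X n w (i : 'I_n) : X i w <= Mn X n w.
Proof. exact: (le_bigmax_cond _ (fun i : 'I_n => X i w)). Qed.

Lemma Mn_ge0 X n w : 0 <= Mn X n w.
Proof. exact: bigmax_ge_id. Qed.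

(** Positivity excludes the default value 0 of the maximum, so some index attains it. *)
Lemma Mn_eq X n w : 0 < Mn X n w -> exists i : 'I_n, Mn X n w = X i w.
Proof.
rewrite /Mn.
elim/big_ind: _ => [|x y hx hy|i _]; first by rewrite ltxx.
- by rewrite /Num.max; case: ifP.
- by exists i.
Qed.

Lemma Sn_gt0 X n w : (forall i, 0 < X i w) -> (0 < n)%N -> 0 < Sn X n w.
Proof.
move=> X0; case: n => // n _; rewrite /Sn big_ord_recl.
by rewrite ltr_pwDl// sumr_ge0// => i _; exact: ltW.
Qed.

Lemma Mn_le_Sn X n w : (forall i, 0 < X i w) -> Mn X n w <= Sn X n w.
Proof.
move=> X0; apply/bigmax_leP; split=> [|i _]; first by apply: sumr_ge0 => i _; exact: ltW.
rewrite /Sn (bigD1 i)//= lerDl sumr_ge0// => j _; exact: ltW.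
Qed.

Lemma Tn_ge0 X n w : (forall i, 0 < X i w) -> 0 <= Tn X n w.
Proof.
move=> X0; apply: divr_ge0; apply: sumr_ge0 => i _; [exact: sqr_ge0|exact: ltW].
Qed.

(** [Tn] is the average of the [X i] with weights [X i]; for [n = 0] its numerator vanishes. *)
Lemma Tn_le_Mn X n w : (forall i, 0 < X i w) -> Tn X n w <= Mn X n w.
Proof.
move=> X0; case: n => [|n]; first by rewrite /Tn big_ord0 mul0r Mn_ge0.
rewrite /Tn ler_pdivrMr ?Sn_gt0// /Sn mulr_sumr; apply: ler_sum => i _.
by rewrite expr2 ler_wpM2r ?Mn_ge// ltW.
Qed.

(** The index that attains the maximum contributes the left-hand side on its own. This is the
    pointwise form of the union bound. *)
Lemma le_sum_indic_gt (k n : nat) X w (L : R) : 0 <= L ->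
  (forall i, 0 < X i w) -> L < Mn X n w ->
  Mn X n w ^+ k <= \sum_(i < n) X i w ^+ k * \1_`]L, +oo[ (X i w).
Proof.
move=> L0 X0 LM; have [i Mi] := Mn_eq X n w (le_lt_trans L0 LM).
rewrite (bigD1 i)//= -Mi indicE mem_set ?mulr1 ?lerDl/=; last by rewrite in_itv/= LM.
apply: sumr_ge0 => j _; apply: mulr_ge0 => //; apply: exprn_ge0; exact: ltW.
Qed.

Lemma Rn_ge0 p X n w : (forall i, 0 < X i w) -> 0 <= Rn p X n w.
Proof.
move=> X0; apply: divr_ge0; last by apply: sumr_ge0 => i _; exact: ltW.
by apply: mulr_ge0; [apply: exprn_ge0; exact: Tn_ge0|exact: sqr_ge0].
Qed.

(* [u] and [v] dominate the indicators of the bad events [Sn < c * n] and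
   [Mn <= L /\ \sum_i X_i ^ 2 > K * n]. *)
Lemma Rn_le p X n w (c K L L' u v : R) : (0 < n)%N ->
  0 < c -> 0 <= K -> 0 < L -> 0 < L' -> 0 <= u -> 0 <= v ->
  (forall i, 0 < X i w) ->
  (Sn X n w < c * n%:R -> 1 <= u) ->
  (Mn X n w <= L -> K * n%:R < \sum_(i < n) X i w ^+ 2 -> 1 <= v) ->
  Rn p X n w <= (c * n%:R) ^+ p.+1 * u +
    (c * n%:R)^-1 * (\sum_(i < n) X i w ^+ p.+2 * \1_`]L, +oo[ (X i w) +
       (K / c) ^+ p * (L' ^+ 2 + \sum_(i < n) X i w ^+ 2 * \1_`]L', +oo[ (X i w)) +
       L ^+ p.+2 * v).
Proof.
move=> n0 c0 K0 L0 L'0 u0 v0 X0 Hu Hv.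
have cn0 : 0 < c * n%:R by rewrite mulr_gt0// ltr0n.
have S0 := Sn_gt0 X n w X0 n0.
have M0 := Mn_ge0 X n w.
have T0 := Tn_ge0 X n w X0.
have TM := Tn_le_Mn X n w X0.
have MS := Mn_le_Sn X n w X0.
have A0 k l : 0 <= \sum_(i < n) X i w ^+ k * \1_`]l, +oo[ (X i w).
  by apply: sumr_ge0 => i _; apply: mulr_ge0 => //; apply: exprn_ge0; exact: ltW.
have K'0 : 0 <= (K / c) ^+ p by rewrite exprn_ge0// divr_ge0// ltW.
have TpM : Tn X n w ^+ p * Mn X n w ^+ 2 <= Mn X n w ^+ p.+2.
  by rewrite -(addn2 p) exprD ler_wpM2r ?sqr_ge0// lerXn2r.
have A2 := A0 p.+2 L; have A1 := A0 2%N L'.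
have Lp0 : 0 <= L ^+ p.+2 by rewrite exprn_ge0// ltW.
have L'0' : 0 <= L' ^+ 2 by rewrite sqr_ge0.
have cnp0 : 0 <= (c * n%:R) ^+ p.+1 by rewrite exprn_ge0// ltW.
have cnV0 : 0 <= (c * n%:R)^-1 by rewrite invr_ge0 ltW.
(* When the sum is small, [T <= M <= S] gives [R <= M ^ (p + 2) / S <= S ^ (p + 1)]. *)
have [Scn|Scn] := ltP (Sn X n w) (c * n%:R).
  rewrite -[leLHS]addr0 lerD//; last by rewrite mulr_ge0// !addr_ge0// mulr_ge0// addr_ge0.
  apply: (@le_trans _ _ ((c * n%:R) ^+ p.+1)); last by rewrite ler_peMr ?Hu.
  rewrite /Rn ler_pdivrMr//; apply: (le_trans TpM).
  rewrite exprSr; apply: ler_pM => //; first exact: exprn_ge0.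
  by rewrite lerXn2r// ?nnegrE ?(ltW cn0)// (le_trans MS)// ltW.
rewrite -[leLHS]add0r lerD//; first by rewrite mulr_ge0.
rewrite /Rn mulrC; apply: ler_pM => //.
- by rewrite invr_ge0 ltW.
- by rewrite mulr_ge0 ?exprn_ge0.
- by rewrite lef_pV2.
have [ML|LM] := leP (Mn X n w) L; last first.
  apply: (le_trans TpM); apply: (le_trans (le_sum_indic_gt p.+2 _ _ _ L (ltW L0) X0 LM)).
  by rewrite -addrA lerDl addr_ge0// mulr_ge0// addr_ge0.
have [Q|Q] := leP (\sum_(i < n) X i w ^+ 2) (K * n%:R); last first.
  rewrite -[leLHS]add0r lerD//; first by rewrite addr_ge0// mulr_ge0// addr_ge0.
  apply: (le_trans TpM); apply: (@le_trans _ _ (L ^+ p.+2)); last by rewrite ler_peMr ?Hv.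
  by rewrite lerXn2r// nnegrE ltW.
(* On the main event [T <= K / c], and it remains to bound [M ^ 2]. The second level [L'] serves
   only this purpose. *)
rewrite -[leLHS]addr0 lerD//; last by rewrite mulr_ge0.
rewrite -[leLHS]add0r lerD//; apply: ler_pM; rewrite ?exprn_ge0//.
  rewrite lerXn2r// ?nnegrE ?divr_ge0 ?(ltW c0)//.
  rewrite /Tn ler_pdivrMr//; apply: (le_trans Q).
  by rewrite -mulrA ler_wpM2l// mulrC ler_pdivlMr// mulrC.
have [ML'|LM'] := leP (Mn X n w) L'.
  by rewrite -[leLHS]addr0 lerD// lerXn2r// nnegrE ltW.
apply: (le_trans (le_sum_indic_gt 2 _ _ _ L' (ltW L'0) X0 LM')).
by rewrite lerDr.
Qed.
End pointwise.

(** * A calculus of upper bounds on means *)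

Section mean_le.
Context {d : measure_display} {T : measurableType d} {R : realType}.
Context {P : probability T R}.
Implicit Types (f g : T -> R) (r s : R).

(** Carrying measurability and nonnegativity along with the bound lets the rules for sums and
    nonnegative multiples compose without repeating these side conditions. *)
Definition mean_le f r : Prop :=
  [/\ measurable_fun setT f, forall w, 0 <= f w & (\int[P]_w (f w)%:E <= r%:E)%E].

Lemma mean_le_trans f r s : mean_le f r -> r <= s -> mean_le f s.
Proof. by move=> [mf f0 fr] rs; split=> //; rewrite (le_trans fr)// lee_fin. Qed.

Lemma mean_le_mono f g r : measurable_fun setT f -> (forall w, 0 <= f w) ->
  (forall w, f w <= g w) -> mean_le g r -> mean_le f r.
Proof.
move=> mf f0 fg [mg g0 gr]; split=> //; apply: le_trans gr.
apply: ge0_le_integral => //.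
- by move=> w _; rewrite lee_fin.
- exact/measurable_EFinP.
- exact/measurable_EFinP.
- by move=> w _; rewrite lee_fin.
Qed.

Lemma mean_le_cst r : 0 <= r -> mean_le (cst r) r.
Proof.
move=> r0; split=> //.
by have := expectation_cst P r; rewrite unlock => ->.
Qed.

Lemma mean_leD f g r s : mean_le f r -> mean_le g s ->
  mean_le (fun w => f w + g w) (r + s).
Proof.
move=> [mf f0 fr] [mg g0 gs]; split.
- exact: measurable_funD.
- by move=> w; exact: addr_ge0.
under eq_integral do rewrite EFinD.
rewrite ge0_integralD//; first by rewrite EFinD leeD.
- by move=> w _; rewrite lee_fin.
- exact/measurable_EFinP.
- by move=> w _; rewrite lee_fin.
- exact/measurable_EFinP.
Qed.

Lemma mean_leZ k f r : 0 <= k -> mean_le f r ->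
  mean_le (fun w => k * f w) (k * r).
Proof.
move=> k0 [mf f0 fr]; split.
- exact: measurable_funM.
- by move=> w; exact: mulr_ge0.
under eq_integral do rewrite EFinM.
rewrite ge0_integralZl_EFin//; first by rewrite EFinM lee_wpmul2l.
- by move=> w _; rewrite lee_fin.
- exact/measurable_EFinP.
Qed.

Lemma mean_le_sum (n : nat) (f : nat -> T -> R) r :
  (forall i, mean_le (f i) r) ->
  mean_le (fun w => \sum_(i < n) f i w) (n%:R * r).
Proof.
move=> fr; elim: n => [|n IH].
  under eq_fun do rewrite big_ord0.
  by rewrite mul0r; exact: mean_le_cst.
under eq_fun do rewrite big_ord_recr.
by rewrite -natr1 mulrDl mul1r; exact: mean_leD.
Qed.
End mean_le.
Arguments mean_le {d T R} P f r.

(** * Means of products over the sample *)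

Section exponential_bounds.
Context {d : measure_display} {T : measurableType d} {R : realType}.
Context {P : probability T R} {X : nat -> {RV P >-> R}}.
Hypothesis iidX : iid X.

Lemma mean_le_RV_comp (i : nat) (f : R -> R) r :
  measurable_fun setT f -> (forall x, 0 <= f x) ->
  mean_le P (fun w => f (X 0%N w)) r ->
  mean_le P (fun w => f (X i w)) r.
Proof.
move=> mf f0 [_ _ fr]; split=> //; first exact: measurableT_comp.
by rewrite (integral_RV_comp i f iidX.2).
Qed.

(** The mean factors into an [n]-th power of a number at most [1 + r], and [1 + r <= expR r]. *)
Lemma mean_le_prod (n m : nat) (b : 'I_m -> R) (B : 'I_m -> set R) r :
  (forall k, 0 <= b k) -> (forall k, measurable (B k)) ->
  mean_le P (fun w => \sum_(k < m) b k * \1_(B k) (X 0%N w)) r ->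
  mean_le P (fun w => \prod_(i < n) (1 + \sum_(k < m) b k * \1_(B k) (X i w)))
    (expR (n%:R * r)).
Proof.
move=> b0 mB br.
have mX i k : measurable_fun setT (fun w => \1_(B k) (X i w) : R).
  by apply: measurableT_comp => //; exact: measurable_indic.
have mS i : measurable_fun setT (fun w => \sum_(k < m) b k * \1_(B k) (X i w)).
  by apply: measurable_sum => k; exact: measurable_funM.
have S0 i w : 0 <= \sum_(k < m) b k * \1_(B k) (X i w).
  by apply: sumr_ge0 => k _; exact: mulr_ge0.
split.
- by apply: measurable_prod => i _; exact: measurable_funD.
- by move=> w; apply: prodr_ge0 => i _; rewrite addr_ge0.
(* The summand 1 becomes one more weighted indicator, that of the whole line. *)
pose b' (k : 'I_m.+1) := if unlift ord0 k is Some j then b j else 1.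
pose B' (k : 'I_m.+1) := if unlift ord0 k is Some j then B j else setT.
have E i w : 1 + \sum_(k < m) b k * \1_(B k) (X i w) =
    \sum_(k < m.+1) b' k * \1_(B' k) (X i w).
  rewrite big_ord_recl /b' /B' unlift_none indicT mulr1; congr (_ + _).
  by apply: eq_bigr => k _; rewrite liftK.
under eq_integral do under eq_bigr do rewrite E.
rewrite integral_prod_sum_indic//; last 2 first.
- by move=> k; rewrite /b'; case: unlift.
- by move=> k; rewrite /B'; case: unlift.
under eq_integral do rewrite -E.
have [_ _ h] := mean_leD _ _ _ _ (mean_le_cst 1 ler01) br.
set I := (\int[_]_w _)%E in h *.
have I0 : (0 <= I)%E by apply: integral_ge0 => w _; rewrite lee_fin addr_ge0.
have Ifin : I \is a fin_num by rewrite ge0_fin_numE// (le_lt_trans h)// ltry.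
rewrite -(fineK Ifin) -EFin_expe lee_fin mulrC expRM_natr.
rewrite lerXn2r// ?nnegrE ?fine_ge0 ?expR_ge0//.
apply: le_trans (expR_ge1Dx r).
by rewrite -lee_fin fineK.
Qed.

End exponential_bounds.

(** * Chernoff bounds for the sum and for the sum of squares *)

Section bounds.
Context {d : measure_display} {T : measurableType d} {R : realType}.
Context {P : probability T R} {X : nat -> {RV P >-> R}}.
Hypothesis iidX : iid X.
Hypothesis X_gt0 : forall i w, 0 < X i w.

(** The events [X <= 1 / (k + 1)] decrease to the empty set because [X] is positive, so their
    probabilities tend to 0. *)
Lemma RV_small_value (e : R) : 0 < e ->
  exists2 a : R, 0 < a & (P (X 0%N @^-1` `]-oo, a]) <= e%:E)%E.
Proof.
move=> e0; pose F (k : nat) := X 0%N @^-1` `]-oo, (k.+1%:R)^-1].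
have mF k : measurable (F k).
  by rewrite -[X in measurable X]setTI; exact: measurable_funP.
have F0 : \bigcap_n F n = set0.
  rewrite -subset0 => w Fw.
  have := Fw (truncn (X 0%N w)^-1) I; rewrite /F/= in_itv/=.
  by rewrite leNgt invf_plt ?posrE ?X_gt0 ?ltr0n// truncnS_gt.
have niF : nonincreasing_seq F.
  move=> m n mn; apply/subsetPset => w; rewrite /F/= !in_itv/= => /le_trans; apply.
  by rewrite lef_pV2 ?posrE ?ltr0n// ler_nat ltnS.
have cF : P \o F @ \oo --> P (\bigcap_n F n).
  apply: nonincreasing_cvg_mu => //; last by rewrite F0.
  by rewrite (le_lt_trans (probability_le1 P (mF 0%N)))// ltry.
rewrite F0 measure0 in cF.
have /cF [k _ /(_ k (leqnn k)) /= /ltW h] : nbhs (0 : \bar R)%E [set y | (y < e%:E)%E].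
  by apply: open_nbhs_nbhs; split => //; exact: open_ereal_lt_ereal.
by exists (k.+1%:R)^-1.
Qed.

(** The function [expR (4 - 4 * X / a)] is at most [1 + expR 4 * 1_(X <= a)]. With
    [P (X <= a) <= expR (- 4)] the last term has mean at most 1, hence the product over the sample
    has mean at most [expR n]. *)
Lemma Sn_lower_deviation : exists2 c : R, 0 < c &
  exists u : nat -> T -> R, forall n, mean_le P (u n) (expR (- n%:R)) /\
    forall w, Sn (fun i => X i : T -> R) n w < c * n%:R -> 1 <= u n w.
Proof.
have [a a0 Pa] := RV_small_value (expR (- 4)) (expR_gt0 _).
pose B (k : 'I_1) : set R := `]-oo, a]%classic.
have mB k : measurable (B k) by exact: measurable_itv.
have mX : measurable (X 0%N @^-1` `]-oo, a]).
  by rewrite -[X in measurable X]setTI; exact: measurable_funP.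
have br : mean_le P
    (fun w => \sum_(k < 1) expR 4 * \1_(B k) (X 0%N w)) 1.
  under eq_fun do rewrite big_ord1.
  apply: (mean_le_trans _ (expR 4 * expR (- 4))); last by rewrite -expRD subrr expR0.
  apply: mean_leZ; first exact: expR_ge0.
  split => //; first by apply: measurableT_comp => //; exact: measurable_indic.
  by rewrite (integral_indic _ _ mX)// setIT.
exists (a / 2); first by rewrite divr_gt0.
(* If [S < (a / 2) * n], the exponents [4 - 4 * X i / a] add up to more than [2 n]. This
   normalisation therefore makes [u] at least 1 there and leaves a mean of at most [expR (- n)]. *)
exists (fun n w => expR (- (n%:R * 2)) *
  \prod_(i < n) (1 + \sum_(k < 1) expR 4 * \1_(B k) (X i w))) => n; split.
  have -> : expR (- n%:R) = expR (- (n%:R * 2)) * expR (n%:R * 1) :> R.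
    by rewrite -expRD; congr expR; ring.
  apply: mean_leZ; first exact: expR_ge0.
  by apply: mean_le_prod => // k; exact: expR_ge0.
move=> w Sa.
have step i : expR (4 - 4 * (X i w / a)) <=
    1 + \sum_(k < 1) expR 4 * \1_(B k) (X i w).
  rewrite big_ord1 indicE /B; case: (leP (X i w) a) => Xa.
    rewrite mem_set ?mulr1/=; last by rewrite in_itv.
    rewrite -[leLHS]add0r lerD// ler_expR gerBl mulr_ge0// divr_ge0// ltW//.
  rewrite memNset ?mulr0 ?addr0/=; last by rewrite in_itv/= leNgt Xa.
  rewrite expR_le1 subr_le0 ler_peMr//.
  by rewrite ler_pdivlMr// mul1r ltW.
have h : expR (\sum_(i < n) (4 - 4 * (X i w / a))) <=
    \prod_(i < n) (1 + \sum_(k < 1) expR 4 * \1_(B k) (X i w)).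
  by rewrite expR_sum; apply: ler_prod => i _; rewrite expR_ge0 step.
rewrite expRN -ler_pdivrMl ?invr_gt0 ?expR_gt0// invrK mulr1.
apply: le_trans h; rewrite ler_expR sumrB sumr_const card_ord.
rewrite -mulr_sumr -mulr_suml -/(Sn (fun i => X i : T -> R) n w).
have : Sn (fun i => X i : T -> R) n w / a < n%:R / 2.
  by rewrite ltr_pdivrMr//; lra.
rewrite -[4 *+ n]mulr_natr; lra.
Qed.

Lemma sum_sqr_upper_deviation (m2 L : R) (n : nat) : 0 < L ->
  mean_le P (fun w => X 0%N w ^+ 2) m2 ->
  exists v : T -> R, mean_le P v (expR (- (n%:R / L ^+ 2))) /\
    forall w, Mn (fun i => X i : T -> R) n w <= L ->
      (2 * m2 + 4) * n%:R < \sum_(i < n) X i w ^+ 2 -> 1 <= v w.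
Proof.
move=> L0 Xm2.
(* Since [N >= L ^ 2], the [N] indicators count up to [X ^ 2] whenever [X <= L]. *)
pose N := (truncn (L ^+ 2)).+1.
have L2N : L ^+ 2 <= N%:R by rewrite ltW// truncnS_gt.
pose B (k : 'I_N) : set R := [set x | k%:R <= x ^+ 2] `&` `]-oo, L]%classic.
have L20 : 0 < L ^+ 2 by rewrite exprn_gt0.
have mB k : measurable (B k).
  apply: measurableI => //.
  rewrite -[X in measurable X]setTI.
  apply: measurable_fun_ler => //.
have Bin k i w : \1_(B k) (X i w) = ((k%:R <= X i w ^+ 2) && (X i w <= L))%:R :> R.
  rewrite indicE; congr (nat_of_bool _)%:R; apply/idP/andP.
    by move/set_mem => -[/= ?]; rewrite in_itv.
  by move=> [h1 h2]; apply/mem_set; split; rewrite //= in_itv.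
have br : mean_le P
    (fun w => \sum_(k < N) (L ^+ 2)^-1 * \1_(B k) (X 0%N w)) ((L ^+ 2)^-1 * (m2 + 1)).
  under eq_fun do rewrite -mulr_sumr.
  apply: mean_leZ; first by rewrite invr_ge0 ltW.
  apply: (@mean_le_mono _ _ _ P _ (fun w => X 0%N w ^+ 2 + 1)).
  - apply: measurable_sum => k.
    by apply: measurableT_comp => //; exact: measurable_indic.
  - by move=> w; apply: sumr_ge0.
  - move=> w; apply: le_trans (count_nat_le _ N (sqr_ge0 (X 0%N w))).
    apply: ler_sum => k _; rewrite Bin ler_nat.
    by case: (_ <= _); case: (_ <= _).
  - by apply: mean_leD => //; exact: mean_le_cst.
(* For [X <= L], [expR (X ^ 2 / (2 L ^ 2)) <= 1 + X ^ 2 / L ^ 2]. The product has mean at most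
   [expR (n (m2 + 1) / L ^ 2)], whereas [Q > (2 m2 + 4) n] forces it above
   [expR (n (m2 + 2) / L ^ 2)]; the gap is the factor [expR (- n / L ^ 2)]. *)
exists (fun w => expR (- ((2 * m2 + 4) * n%:R / (2 * L ^+ 2))) *
  \prod_(i < n) (1 + \sum_(k < N) (L ^+ 2)^-1 * \1_(B k) (X i w))); split.
  have -> : expR (- (n%:R / L ^+ 2)) = expR (- ((2 * m2 + 4) * n%:R / (2 * L ^+ 2))) *
      expR (n%:R * ((L ^+ 2)^-1 * (m2 + 1))) :> R.
    by rewrite -expRD; congr expR; field; rewrite gt_eqF.
  apply: mean_leZ; first exact: expR_ge0.
  by apply: mean_le_prod => // k; rewrite invr_ge0 ltW.
move=> w ML Qn.
have XL i : (i < n)%N -> X i w <= L.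
  move=> i_n; apply: le_trans ML.
  exact: (Mn_ge (fun i => X i : T -> R) n w (Ordinal i_n)).
have step (i : 'I_n) : expR (X i w ^+ 2 / (2 * L ^+ 2)) <=
    1 + \sum_(k < N) (L ^+ 2)^-1 * \1_(B k) (X i w).
  have X2L : X i w ^+ 2 <= L ^+ 2 by rewrite lerXn2r ?nnegrE ?XL// ltW.
  apply: le_trans (expR_le_1D2x _ _) _.
    apply/andP; split; first by rewrite divr_ge0 ?sqr_ge0// mulr_ge0// ltW.
    rewrite ler_pdivrMr ?mulr_gt0//; lra.
  rewrite lerD2l -mulr_sumr.
  have -> : 2 * (X i w ^+ 2 / (2 * L ^+ 2)) = (L ^+ 2)^-1 * X i w ^+ 2.
    by field; rewrite gt_eqF.
  rewrite ler_wpM2l ?invr_ge0 ?(ltW L20)//.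
  apply: le_trans (count_nat_ge _ N (sqr_ge0 _) (le_trans X2L L2N)) _.
  by apply: ler_sum => k _; rewrite Bin XL// andbT.
have h : expR (\sum_(i < n) (X i w ^+ 2 / (2 * L ^+ 2))) <=
    \prod_(i < n) (1 + \sum_(k < N) (L ^+ 2)^-1 * \1_(B k) (X i w)).
  by rewrite expR_sum; apply: ler_prod => i _; rewrite expR_ge0 step.
rewrite expRN -ler_pdivrMl ?invr_gt0 ?expR_gt0// invrK mulr1.
apply: le_trans h; rewrite ler_expR -mulr_suml.
by rewrite ler_wpM2r ?invr_ge0 ?mulr_ge0// ltW.
Qed.
End bounds.

(** * From truncated moments to a rate for the mean of [Rn] *)

Section rate.
Context {d : measure_display} {T : measurableType d} {R : realType}.
Context {P : probability T R} {X : nat -> {RV P >-> R}}.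
Hypothesis iidX : iid X.
Hypothesis X_gt0 : forall i w, 0 < X i w.
Let Xf : nat -> T -> R := fun i => X i : T -> R.

Lemma measurable_Rn p n : (0 < n)%N -> measurable_fun setT (Rn p Xf n).
Proof.
move=> n0.
have mS : measurable_fun setT (Sn Xf n) by apply: measurable_sum => i.
have mSV : measurable_fun setT (fun w => (Sn Xf n w)^-1).
  (* The sum is positive, so its inverse is the power of exponent -1, and measurability follows by
     composition. *)
  have -> : (fun w => (Sn Xf n w)^-1) = (fun w => powR (Sn Xf n w) (- 1)).
    apply/funext => w; rewrite powR_inv1// ltW// Sn_gt0// => i; exact: X_gt0.
  apply: (@measurableT_comp _ _ _ _ _ _ (@powR R ^~ (- 1)) setT (Sn Xf n)) => //.
have mM : measurable_fun setT (Mn Xf n).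
  rewrite /Mn; elim: (index_enum _) => [|i s IH].
    by under eq_fun do rewrite big_nil; exact: measurable_cst.
  by under eq_fun do rewrite big_cons; exact: measurable_maxr.
apply: measurable_funM => //; apply: measurable_funM; apply: measurable_funX => //.
apply: measurable_funM => //; apply: measurable_sum => i; exact: measurable_funX.
Qed.

(** This is [Rn_le] integrated, with [K = 2 * m2 + 4]. The constant [c] is fixed before [p], [n] and
    the levels, so it can enter the constants of a rate. *)
Lemma mean_le_Rn : exists2 c : R, 0 < c &
  forall p n (L L' m2 e1 e2 : R), (0 < n)%N -> 0 < L -> 0 < L' -> 0 <= m2 ->
    mean_le P (fun w => X 0%N w ^+ 2) m2 ->
    mean_le P (fun w => X 0%N w ^+ p.+2 * \1_`]L, +oo[ (X 0%N w)) e1 ->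
    mean_le P (fun w => X 0%N w ^+ 2 * \1_`]L', +oo[ (X 0%N w)) e2 ->
    mean_le P (Rn p Xf n) ((c * n%:R) ^+ p.+1 * expR (- n%:R) +
      (c * n%:R)^-1 * (n%:R * e1 + ((2 * m2 + 4) / c) ^+ p * (L' ^+ 2 + n%:R * e2) +
        L ^+ p.+2 * expR (- (n%:R / L ^+ 2)))).
Proof.
have [c c0 [u Hu]] := Sn_lower_deviation iidX X_gt0.
exists c => // p n L L' m2 e1 e2 n0 L0 L'0 m20 hm2 he1 he2.
have [v [hv Hv]] := sum_sqr_upper_deviation iidX X_gt0 m2 L n L0 hm2.
have [hu Hu'] := Hu n.
have cn0 : 0 <= c * n%:R by rewrite mulr_ge0// ltW.
have K0 : 0 <= 2 * m2 + 4 by rewrite addr_ge0// mulr_ge0.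
have trunc k l e : 0 <= l ->
    mean_le P (fun w => X 0%N w ^+ k * \1_`]l, +oo[ (X 0%N w)) e ->
    mean_le P (fun w => \sum_(i < n) X i w ^+ k * \1_`]l, +oo[ (X i w)) (n%:R * e).
  move=> l0 h.
  apply: (mean_le_sum n (fun i w => X i w ^+ k * \1_`]l, +oo[ (X i w))) => i.
  apply: (mean_le_RV_comp iidX i (fun x => x ^+ k * \1_`]l, +oo[ x)) => //.
    exact: measurable_exprn_indic_gt.
  by move=> x; exact: exprn_indic_gt_ge0.
apply: (mean_le_mono _ (fun w => (c * n%:R) ^+ p.+1 * u n w +
    (c * n%:R)^-1 * (\sum_(i < n) X i w ^+ p.+2 * \1_`]L, +oo[ (X i w) +
       ((2 * m2 + 4) / c) ^+ p *
         (L' ^+ 2 + \sum_(i < n) X i w ^+ 2 * \1_`]L', +oo[ (X i w)) +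
       L ^+ p.+2 * v w))).
- exact: measurable_Rn.
- by move=> w; apply: Rn_ge0 => i; exact: X_gt0.
- move=> w; apply: Rn_le => //.
  + by case: hu.
  + by case: hv.
  + by move=> i; exact: X_gt0.
  + exact: Hu'.
  + exact: Hv.
apply: mean_leD; first by apply: mean_leZ => //; exact: exprn_ge0.
apply: mean_leZ; first by rewrite invr_ge0.
apply: mean_leD.
  apply: mean_leD; first by apply: trunc => //; exact: ltW.
  apply: mean_leZ; first by rewrite exprn_ge0// divr_ge0// ltW.
  apply: mean_leD; first by apply: mean_le_cst; rewrite sqr_ge0.
  by apply: trunc => //; exact: ltW.
by apply: mean_leZ => //; rewrite exprn_ge0// ltW.
Qed.

(** A rate [r] is reduced to a choice of two levels: [L] truncates [M ^ (p + 2)] and [L'] truncates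
    [M ^ 2]. The condition [L <= a * n ^ l] with [l < 1 / 2] keeps
    [L ^ (p + 2) * expR (- n / L ^ 2)] bounded, and the last condition says that [1 / n] is at most
    a multiple of [r n]. *)
Lemma mean_Rn_rate (p : nat) (r L L' : nat -> R) (C a l : R) (N : nat) :
  0 < a -> l < 1 / 2 -> 0 <= C ->
  (forall n, (N <= n)%N -> (0 < n)%N -> [/\ 0 < L n, L n <= a * n%:R `^ l & 0 < L' n]) ->
  (forall n, (N <= n)%N -> (0 < n)%N ->
    mean_le P (fun w => X 0%N w ^+ p.+2 * \1_`]L n, +oo[ (X 0%N w)) (C * r n)) ->
  (forall n, (N <= n)%N -> (0 < n)%N ->
    mean_le P (fun w => X 0%N w ^+ 2 * \1_`]L' n, +oo[ (X 0%N w)) (C * r n)) ->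
  (forall n, (N <= n)%N -> (0 < n)%N -> L' n ^+ 2 <= C * (n%:R * r n)) ->
  (forall n, (N <= n)%N -> (0 < n)%N -> 1 <= C * (n%:R * r n)) ->
  exists C' : R, exists N' : nat, forall n : nat, (N' <= n)%N ->
    ('E_P[Rn p Xf n] <= (C' * r n)%:E)%E.
Proof.
move=> a0 l2 C0 HL He1 He2 HL' Hr.
have [c c0 Hc] := mean_le_Rn.
have [D D0 HD] := exprn_mul_expR_bounded p.+2 a l a0 l2.
(* The second moment is bounded from the truncated one at the single index [N + 1], where the
   hypotheses hold: [X ^ 2 <= L' ^ 2 + X ^ 2 * 1_(X > L')]. *)
pose m2 := L' N.+1 ^+ 2 + C * r N.+1.
have r0 n : (N <= n)%N -> (0 < n)%N -> 0 <= C * r n.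
  move=> Nn n0; have := le_trans ler01 (Hr n Nn n0).
  by rewrite mulrCA pmulr_rge0// ltr0n.
have hm2 : mean_le P (fun w => X 0%N w ^+ 2) m2.
  have [_ _ L'0] := HL N.+1 (leqnSn N) (ltn0Sn N).
  apply: (mean_le_mono _ (fun w => L' N.+1 ^+ 2 +
      X 0%N w ^+ 2 * \1_`]L' N.+1, +oo[ (X 0%N w))).
  - exact: measurable_funX.
  - by move=> w; exact: sqr_ge0.
  - move=> w; rewrite indicE; have [_|/negP h] := boolP (_ \in _).
      by rewrite mulr1 lerDr sqr_ge0.
    rewrite mulr0 addr0 lerXn2r ?nnegrE ?(ltW L'0) ?(ltW (X_gt0 _ _))//.
    rewrite leNgt; apply/negP => h'; apply: h; apply/mem_set.
    by rewrite /= in_itv/= h'.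
  - apply: mean_leD; last exact: He2.
    by apply: mean_le_cst; exact: sqr_ge0.
have m20 : 0 <= m2 by rewrite addr_ge0 ?sqr_ge0 ?r0.
pose K := ((2 * m2 + 4) / c) ^+ p.
have K0 : 0 <= K by rewrite exprn_ge0// divr_ge0 ?addr_ge0 ?mulr_ge0// ltW.
(* The first summand comes from [n ^ (p + 2) <= (p + 2)! * expR n], which bounds
   [(c n) ^ (p + 1) * expR (- n)] by a multiple of [1 / n]. Starting at [N + 1] ensures [n > 0]. *)
exists (c ^+ p.+1 * (p.+2)`!%:R * C + c^-1 * (C + K * (C + C) + D * C)), N.+1 => n Nn.
have n0 : (0 < n)%N by case: n Nn.
have {}Nn : (N <= n)%N by rewrite (leq_trans _ Nn).
have [L0 La L'0] := HL n Nn n0.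
have [_ _ h] := Hc p n (L n) (L' n) m2 _ _ n0 L0 L'0 m20 hm2 (He1 n Nn n0) (He2 n Nn n0).
rewrite unlock; apply: (le_trans h); rewrite lee_fin -/K.
have nR : 0 < n%:R :> R by rewrite ltr0n.
have nV : n%:R^-1 <= C * r n.
  by rewrite -div1r ler_pdivrMr// -mulrA [r n * _]mulrC Hr.
have := HD n (L n) n0 L0 La; set E := _ * expR _ => HE.
rewrite mulrDl; apply: lerD.
  apply: (@le_trans _ _ (c ^+ p.+1 * (p.+2)`!%:R * n%:R^-1)); last first.
    rewrite -[leRHS]mulrA ler_wpM2l// mulr_ge0// exprn_ge0// ltW//.
  rewrite exprMn -!mulrA ler_wpM2l ?exprn_ge0 ?(ltW c0)//.
  rewrite expRN ler_pdivrMr ?expR_gt0// mulrAC ler_pdivlMr// -exprSr.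
  exact: exprn_le_fact_expR.
rewrite invfM -[leLHS]mulrA -[leRHS]mulrA ler_wpM2l ?invr_ge0 ?(ltW c0)//.
rewrite [leLHS](_ : _ = C * r n + K * (L' n ^+ 2 / n%:R + C * r n) + E / n%:R);
  last by field; rewrite gt_eqF.
rewrite [leRHS](_ : _ = C * r n + K * (C * r n + C * r n) + D * (C * r n)); last by ring.
apply: lerD; first apply: lerD => //.
  by rewrite ler_wpM2l// lerD// ler_pdivrMr// -mulrA [r n * _]mulrC; exact: HL'.
apply: ler_pM => //.
by rewrite /E mulr_ge0 ?expR_ge0// exprn_ge0// ltW.
Qed.
End rate.

(** * Moments restricted to large values, from a moment, an exponential moment or a tail bound *)

Section truncated_moments.
Context {d : measure_display} {T : measurableType d} {R : realType}.
Context {P : probability T R} {Y : {RV P >-> R}}.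
Hypothesis Y_gt0 : forall w, 0 < Y w.

Lemma mean_le_fine (f : T -> R) : measurable_fun setT f -> (forall w, 0 <= f w) ->
  ('E_P[f] < +oo)%E -> mean_le P f (fine 'E_P[f]%E).
Proof.
move=> mf f0; rewrite unlock => foo; split=> //.
rewrite fineK// ge0_fin_numE//.
by apply: integral_ge0 => w _; rewrite lee_fin.
Qed.

Let measurable_trunc k (L : R) :
  measurable_fun setT (fun w => Y w ^+ k * \1_`]L, +oo[ (Y w)).
Proof.
exact: (measurableT_comp (measurable_exprn_indic_gt k L)).
Qed.

Lemma mean_le_trunc_moment (k j : nat) (L m : R) : 0 < L ->
  mean_le P (fun w => Y w ^+ (k + j)) m ->
  mean_le P (fun w => Y w ^+ k * \1_`]L, +oo[ (Y w)) ((L ^+ j)^-1 * m).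
Proof.
move=> L0 hm; have Lj : 0 < L ^+ j by exact: exprn_gt0.
apply: (mean_le_mono _ (fun w => (L ^+ j)^-1 * Y w ^+ (k + j))) => //.
- by move=> w; apply: exprn_indic_gt_ge0; exact: ltW.
- move=> w; rewrite indicE; have [/set_mem|_] := boolP (_ \in _); last first.
    by rewrite mulr0 mulr_ge0 ?invr_ge0 ?exprn_ge0 ?ltW.
  rewrite /= in_itv/= andbT mulr1 => LY.
  rewrite ler_pdivlMl// exprD mulrC ler_wpM2l ?exprn_ge0 ?(ltW (Y_gt0 w))//.
  by rewrite lerXn2r ?nnegrE ?ltW.
- by apply: mean_leZ => //; rewrite invr_ge0 ltW.
Qed.

(** Half of the exponent pays for [Y ^ k], through [y ^ k <= k! * expR y] at [y = e Y / 2]. The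
    other half gives the factor [expR (- e L / 2)] when [Y > L]. *)
Lemma mean_le_trunc_expR (k : nat) (e L m : R) : 0 < e -> 0 <= L ->
  mean_le P (fun w => expR (e * Y w)) m ->
  mean_le P (fun w => Y w ^+ k * \1_`]L, +oo[ (Y w))
    (k`!%:R * (2 / e) ^+ k * expR (- (e / 2 * L)) * m).
Proof.
move=> e0 L0 hm.
have c0 : 0 <= k`!%:R * (2 / e) ^+ k * expR (- (e / 2 * L)).
  by rewrite !mulr_ge0 ?expR_ge0 ?exprn_ge0 ?divr_ge0 ?(ltW e0).
apply: (mean_le_mono _ (fun w => k`!%:R * (2 / e) ^+ k * expR (- (e / 2 * L)) *
  expR (e * Y w))) => //.
- by move=> w; exact: exprn_indic_gt_ge0.
- move=> w; rewrite indicE; have [/set_mem|_] := boolP (_ \in _); last first.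
    by rewrite mulr0 mulr_ge0 ?expR_ge0.
  rewrite /= in_itv/= andbT mulr1 => LY.
  have Y0 := ltW (Y_gt0 w).
  have eY : 0 <= e / 2 * Y w by rewrite mulr_ge0// divr_ge0// ltW.
  have -> : Y w ^+ k = (2 / e) ^+ k * (e / 2 * Y w) ^+ k.
    by rewrite -exprMn; congr (_ ^+ _); field; rewrite gt_eqF.
  rewrite -[in leRHS]mulrA -[in leRHS]mulrA [leRHS]mulrCA ler_wpM2l ?exprn_ge0 ?divr_ge0 ?(ltW e0)//.
  apply: (le_trans (exprn_le_fact_expR _ k eY)).
  rewrite ler_wpM2l// -expRD ler_expR.
  have : e / 2 * L <= e / 2 * Y w by rewrite ler_wpM2l ?divr_ge0 ?ltW.
  lra.
- exact: mean_leZ.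
Qed.

(* Split [X > L] along the dyadic levels [2 ^ j * L]. *)
Lemma mean_le_trunc_tail (k : nat) (s C x0 L : R) : 1 <= s -> 0 <= C ->
  (forall x, x0 <= x -> (P (Y @^-1` `[x, +oo[) <= (C * x `^ (- (k%:R + s)))%:E)%E) ->
  0 < L -> x0 <= L ->
  mean_le P (fun w => Y w ^+ k * \1_`]L, +oo[ (Y w)) (2 ^+ k.+1 * C * L `^ (- s)).
Proof.
move=> s1 C0 tail L0 x0L.
have lev0 j : 0 < 2 ^+ j * L by rewrite mulr_gt0 ?exprn_gt0.
pose A j := Y @^-1` `[2 ^+ j * L, +oo[%classic.
have mA j : measurable (A j).
  by rewrite -[X in measurable X]setTI; exact: measurable_funP.
pose g j w : \bar R := ((2 ^+ j.+1 * L) ^+ k * \1_(A j) w)%:E.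
have g0 j w : (0 <= g j w)%E by rewrite lee_fin mulr_ge0 ?exprn_ge0// (ltW (lev0 _)).
have mg j : measurable_fun setT (g j).
  by apply/measurable_EFinP; apply: measurable_funM.
split=> //.
- by move=> w; apply: exprn_indic_gt_ge0; exact: ltW.
apply: (@le_trans _ _ (\int[P]_w \sum_(j <oo) g j w)%E).
  apply: ge0_le_integral => //.
  - by move=> w _; rewrite lee_fin; apply: exprn_indic_gt_ge0; exact: ltW.
  - exact/measurable_EFinP.
  - by apply: ge0_emeasurable_sum.
  move=> w _; rewrite indicE; have [/set_mem|_] := boolP (_ \in _); last first.
    by rewrite mulr0; apply: nneseries_ge0.
  rewrite /= in_itv/= andbT mulr1 => LY.
  have YL1 : 1 < Y w / L by rewrite ltr_pdivlMr// mul1r.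
  (* The dyadic level of [Y]: [2 ^ j * L <= Y <= 2 ^ (j + 1) * L], so the single term [g j] already
     dominates. *)
  pose j := trunc_log 2 (truncn (Y w / L)).
  have t0 : (0 < truncn (Y w / L))%N by rewrite truncn_gt0 ltW.
  have /andP[j1 j2] := trunc_log_bounds (isT : (1 < 2)%N) t0.
  have YL0 : 0 <= Y w / L by rewrite (le_trans ler01)// ltW.
  have lo : 2 ^+ j * L <= Y w.
    rewrite -ler_pdivlMr//; apply: le_trans (_ : (truncn (Y w / L))%:R <= _).
      by rewrite -natrX ler_nat.
    by rewrite truncn_le.
  have hi : Y w <= 2 ^+ j.+1 * L.
    rewrite -ler_pdivrMr// ltW// (lt_le_trans (truncnS_gt _))//.
    by rewrite -natrX ler_nat.
  apply: le_trans (nneseries_lim_ge j.+1 (fun i _ _ => g0 i w)).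
  rewrite big_nat_recr//=; apply: (@le_trans _ _ (g j w)); last first.
    by rewrite leeDr// sume_ge0.
  rewrite /g indicE mem_set ?mulr1; last by rewrite /A/= in_itv/= lo.
  by rewrite lee_fin lerXn2r// nnegrE; [exact: ltW|exact: ltW (lev0 _)].
rewrite integral_nneseries//.
(* The tail bound makes the [j]-th integral at most [2 ^ k * C * (2 ^ j * L) ^ (- s)]. As [s >= 1],
   this is at most [M / 2 ^ (j + 1)], and these terms sum to [M]. *)
set M := 2 ^+ k.+1 * C * L `^ (- s).
have M0 : 0 <= M by rewrite !mulr_ge0 ?exprn_ge0 ?powR_ge0.
apply: (@le_trans _ _ (\sum_(j <oo) (M / (2 ^ j.+1)%:R)%:E)%E); last exact: epsilon_trick0.
apply: lee_nneseries => j _.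
  by rewrite integral_ge0.
rewrite /g; under eq_integral do rewrite EFinM.
rewrite ge0_integralZl_EFin//; last 2 first.
- by apply/measurable_EFinP; exact: measurable_indic.
- by rewrite exprn_ge0// ltW.
rewrite (integral_indic _ _ (mA j))// setIT.
have jL : x0 <= 2 ^+ j * L.
  by rewrite (le_trans x0L)// ler_peMl ?(ltW L0)// exprn_ege1// ler1n.
apply: (@le_trans _ _ (((2 ^+ j.+1 * L) ^+ k)%:E *
    (C * (2 ^+ j * L) `^ (- (k%:R + s)))%:E)%E).
  rewrite lee_wpmul2l ?lee_fin ?exprn_ge0 ?(ltW (lev0 _))//.
  exact: tail.
rewrite -EFinM lee_fin opprD powRD; last by rewrite (gt_eqF (lev0 j)) implybT.
rewrite powR_invn ?(ltW (lev0 _))// [(2 ^+ j.+1 * L)](_ : _ = 2 * (2 ^+ j * L)); last first.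
  by rewrite exprS mulrA.
have -> : (2 * (2 ^+ j * L)) ^+ k *
    (C * ((2 ^+ j * L) ^- k * (2 ^+ j * L) `^ (- s))) =
    2 ^+ k * C * (2 ^+ j * L) `^ (- s).
  have := gt_eqF (lev0 j); move: (_ * L) => y y0.
  by rewrite exprMn; field; rewrite expf_neq0// y0.
rewrite powRM ?exprn_ge0 ?(ltW L0)//.
rewrite [leRHS](_ : _ = 2 ^+ k * C * ((2 ^+ j)^-1 * L `^ (- s))); last first.
  by rewrite natrX /M !exprS; field; rewrite expf_neq0.
rewrite ler_wpM2l ?mulr_ge0 ?exprn_ge0// ler_wpM2r ?powR_ge0//.
have j1 : 1 <= 2 ^+ j :> R by rewrite exprn_ege1// ler1n.
rewrite powRN lef_pV2 ?posrE ?powR_gt0 ?exprn_gt0//.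
exact: le1r_powR.
Qed.
End truncated_moments.

(** * Choice of the levels under the three assumptions *)

Theorem theorem3 (d : measure_display) (T : measurableType d) (R : realType)
  (P : probability T R) (X : nat -> {RV P >-> R}) (p : nat) :
  iid X -> (forall i w, 0 < X i w) -> (2 <= p)%N ->
  (* (1) tail P(X >= x) = O(x^{-p-7/2}) implies E R_n = O(n^{-1/2}) *)
  ((exists C x0 : R, forall x : R, x0 <= x ->
      (P (X 0%N @^-1` `[x, +oo[) <= (C * x `^ (- (p%:R + 7 / 2)))%:E)%E) ->
   exists C : R, exists N : nat, forall n : nat, (N <= n)%N ->
      ('E_P[Rn p (fun i => X i : T -> R) n] <= (C * n%:R `^ (- (1 / 2)))%:E)%E)
  /\
  (* (2) p > 8 and E X^{p+4} < oo implies E R_n = O(n^{-(p-2)/(p+4)}) *)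
  ((8 < p)%N -> ('E_P[fun w => (X 0%N w ^+ (p + 4))%R] < +oo)%E ->
   exists C : R, exists N : nat, forall n : nat, (N <= n)%N ->
      ('E_P[Rn p (fun i => X i : T -> R) n]
        <= (C * n%:R `^ (- ((p%:R - 2) / (p%:R + 4))))%:E)%E)
  /\
  (* (3) E e^{eps X} < oo for some eps > 0 implies E R_n = O((log n)^2 / n) *)
  ((exists eps : R, 0 < eps /\ ('E_P[fun w => (expR (eps * X 0%N w))%R] < +oo)%E) ->
   exists C : R, exists N : nat, forall n : nat, (N <= n)%N ->
      ('E_P[Rn p (fun i => X i : T -> R) n] <= (C * (ln n%:R) ^+ 2 / n%:R)%:E)%E).
Proof.
move=> iidX X0 p2.
have ler_powRn (a b : R) (n : nat) : (0 < n)%N -> a <= b -> n%:R `^ a <= n%:R `^ b :> R.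
  by move=> n0; apply: ler_powR; rewrite ler1n.
have powRn_gt0 (a : R) (n : nat) : (0 < n)%N -> 0 < n%:R `^ a :> R.
  by move=> n0; rewrite powR_gt0// ltr0n.
have mulnpowR (a : R) (n : nat) : (0 < n)%N -> n%:R * n%:R `^ (- a) = n%:R `^ (1 - a) :> R.
  move=> n0; rewrite powRD; last by rewrite pnatr_eq0 -lt0n n0 implybT.
  by rewrite powRr1.
have p2R : 2 <= p%:R :> R by rewrite ler_nat.
split; [|split].
- move=> [C [x0 tail]].
  (* A probability is nonnegative, and at [max x0 1] the power that multiplies [C] is positive. *)
  have C0 : 0 <= C.
    have x1 : x0 <= Num.max x0 1 by rewrite le_max lexx.
    have := le_trans (measure_ge0 P _) (tail _ x1).
    by rewrite lee_fin pmulr_lge0// powR_gt0// lt_max ltr01 orbT.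
  pose C1 := 2 ^+ p.+3 * C; pose C2 := 2 ^+ 3 * C.
  have C10 : 0 <= C1 by rewrite mulr_ge0.
  have C20 : 0 <= C2 by rewrite mulr_ge0.
  have large (n : nat) (a : R) : ((truncn (Num.max x0 1 ^+ 4)%R).+1 <= n)%N -> (0 < n)%N ->
      1 / 4 <= a -> x0 <= n%:R `^ a.
    move=> hn n0 a4; apply: (@le_trans _ _ (n%:R `^ (1 / 4))); last exact: ler_powRn.
    have x1 : 1 <= Num.max x0 1 by rewrite le_max lexx orbT.
    apply: (@le_trans _ _ (Num.max x0 1)); first by rewrite le_max lexx.
    have -> : Num.max x0 1 = (Num.max x0 1 ^+ 4) `^ (1 / 4).
      rewrite -powR_mulrn ?(le_trans ler01)// -powRrM mulrC divfK//.
      by rewrite powRr1// (le_trans ler01).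
    rewrite ge0_ler_powR// ?nnegrE ?ler0n ?exprn_ge0 ?(le_trans ler01 x1)//.
    by rewrite ltW// (lt_le_trans (truncnS_gt _))// ler_nat.
  (* Writing [p + 7/2 = (p + 2) + 3/2], the level [L = n ^ (1/3)] gives [L ^ (- 3/2) = n ^ (- 1/2)].
     The level [L' = n ^ (1/4)] is the one with [L' ^ 2 = n * n ^ (- 1/2)], and
     [(p + 3/2) / 4 >= 1/2] handles the truncated second moment. *)
  apply: (mean_Rn_rate iidX X0 p (fun n => n%:R `^ (- (1 / 2))) (fun n => n%:R `^ (1 / 3)) (fun n => n%:R `^ (1 / 4))
    (C1 + C2 + 1) 1 (1 / 3) (truncn (Num.max x0 1 ^+ 4)%R).+1) => //.
  + lra.
  + by rewrite !addr_ge0.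
  + by move=> n _ n0; rewrite [1 * n%:R `^ _]mul1r !powRn_gt0.
  + move=> n hn n0; apply: mean_le_trans.
      apply: (mean_le_trunc_tail (X0 0%N) p.+2 (3 / 2) C x0) => //.
      * lra.
      * move=> x /tail; rewrite (_ : p%:R + 7 / 2 = p.+2%:R + 3 / 2 :> R)//.
        by rewrite -addn2 natrD; lra.
      * exact: powRn_gt0.
      * by apply: large => //; lra.
    rewrite -powRrM (_ : 1 / 3 * - (3 / 2) = - (1 / 2) :> R); last by lra.
    by rewrite ler_wpM2r ?powR_ge0// -/C1; lra.
  + move=> n hn n0; apply: mean_le_trans.
      apply: (mean_le_trunc_tail (X0 0%N) 2 (p%:R + 3 / 2) C x0) => //.
      * lra.
      * by move=> x /tail; rewrite (_ : p%:R + 7 / 2 = 2%:R + (p%:R + 3 / 2) :> R)//; lra.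
      * exact: powRn_gt0.
      * by apply: large => //; lra.
    rewrite -powRrM -/C2; apply: ler_pM; rewrite ?powR_ge0//; first by lra.
    by apply: ler_powRn => //; lra.
  + move=> n hn n0; rewrite mulnpowR// -powR_mulrn ?powR_ge0// -powRrM.
    apply: (@le_trans _ _ (1 * n%:R `^ (1 - 1 / 2))).
      by rewrite [leRHS]mul1r ler_powRn//; lra.
    by rewrite ler_wpM2r ?powR_ge0//; lra.
  + move=> n hn n0; rewrite mulnpowR//.
    have : 1 <= n%:R `^ (1 - 1 / 2) :> R.
      by rewrite -[leLHS](powRr0 n%:R) ler_powRn//; lra.
    by move=> h; rewrite mulr_ege1//; lra.
- move=> p8 foo.
  have p8R : 8 < p%:R :> R by rewrite ltr_nat.
  set b := (p%:R - 2) / (p%:R + 4).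
  have q0 : 0 < p%:R + 4 :> R by lra.
  have b01 : 0 < b < 1.
    by rewrite /b divr_gt0 ?ltr_pdivrMr//; lra.
  set m := fine 'E_P[fun w => (X 0%N w ^+ (p + 4))%R]%E.
  have hm : mean_le P (fun w => X 0%N w ^+ (p + 4)) m.
    apply: mean_le_fine => //; first exact: measurable_funX.
    by move=> w; rewrite exprn_ge0// ltW.
  have m0 : 0 <= m.
    by apply/fine_ge0; rewrite expectation_ge0// => w; rewrite exprn_ge0// ltW.
  (* Here [L ^ (- 2) = n ^ (- b)] multiplies the moment of order [p + 4], and [L' ^ 2 = n ^ (1 - b)]
     is exactly [n] times the rate. *)
  apply: (mean_Rn_rate iidX X0 p (fun n => n%:R `^ (- b)) (fun n => n%:R `^ (b / 2)) (fun n => n%:R `^ ((1 - b) / 2))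
    (m + 1) 1 (b / 2) 0) => //.
  + lra.
  + by rewrite addr_ge0.
  + by move=> n _ n0; rewrite [1 * n%:R `^ _]mul1r !powRn_gt0.
  + move=> n hn n0; apply: mean_le_trans.
      apply: (mean_le_trunc_moment (X0 0%N) p.+2 2 _ m); first exact: powRn_gt0.
      by rewrite addSnnS addSnnS.
    rewrite -powR_mulrn ?powR_ge0// -powRrM divfK// -powRN mulrC.
    by rewrite ler_wpM2r ?powR_ge0// lerDl.
  + move=> n hn n0; apply: mean_le_trans.
      apply: (mean_le_trunc_moment (X0 0%N) 2 p.+2 _ m); first exact: powRn_gt0.
      by rewrite addnC addSnnS addSnnS.
    rewrite -powR_mulrn ?powR_ge0// -powRrM -powRN mulrC.
    apply: ler_pM; rewrite ?powR_ge0// ?lerDl//.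
    (* Since [(1 - b) / 2 = 3 / (p + 4)], the comparison of exponents reduces to
       [p - 2 <= 3 * (p + 2)]. *)
    apply: ler_powRn => //; rewrite lerN2.
    have -> : (1 - b) / 2 = 3 / (p%:R + 4) by rewrite /b; field; rewrite gt_eqF.
    rewrite /b mulrAC ler_pM2r ?invr_gt0// -addn2 natrD; lra.
  + move=> n hn n0; rewrite mulnpowR// -powR_mulrn ?powR_ge0// -powRrM divfK//.
    by rewrite ler_peMl ?powR_ge0// lerDr.
  + move=> n hn n0; rewrite mulnpowR//.
    have : 1 <= n%:R `^ (1 - b) :> R.
      by rewrite -[leLHS](powRr0 n%:R) ler_powRn//; lra.
    by move=> h; rewrite mulr_ege1// lerDr.
- move=> [e [e0 foo]].
  set m := fine 'E_P[fun w => expR (e * X 0%N w)]%E.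
  have hm : mean_le P (fun w => expR (e * X 0%N w)) m.
    apply: mean_le_fine => //; apply: (measurableT_comp (@measurable_expR R)).
    exact: measurable_funM.
  have m0 : 0 <= m by apply/fine_ge0; rewrite expectation_ge0// => w; exact: expR_ge0.
  pose D k := k`!%:R * (2 / e) ^+ k * m.
  have D0 k : 0 <= D k by rewrite !mulr_ge0 ?exprn_ge0 ?divr_ge0 ?(ltW e0).
  pose C := D p.+2 + D 2%N + (2 / e) ^+ 2 + 1.
  have C0 : 0 <= C by rewrite !addr_ge0// sqr_ge0.
  have ln1 (n : nat) : ((truncn (expR 1 : R)).+1 <= n)%N -> 1 <= ln (n%:R : R).
    move=> hn; rewrite -[leLHS]expRK ler_ln ?posrE ?expR_gt0//.
      by rewrite ltW// (lt_le_trans (truncnS_gt _))// ler_nat.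
    by rewrite ltr0n (leq_trans _ hn).
  (* At the level [(2 / e) * ln n] the factor [expR (- (e / 2) * L)] equals [1 / n]; the logarithms
     are then added for free because [ln n >= 1]. *)
  have hE k n : ((truncn (expR 1 : R)).+1 <= n)%N -> (0 < n)%N -> D k <= C ->
      mean_le P (fun w => X 0%N w ^+ k * \1_`]2 / e * ln n%:R, +oo[ (X 0%N w))
        (C * (ln n%:R ^+ 2 / n%:R)).
    move=> hn n0 DC; have l1 := ln1 n hn.
    apply: mean_le_trans.
      apply: (mean_le_trunc_expR (X0 0%N) k e _ m) => //.
      by rewrite mulr_ge0 ?divr_ge0 ?(ltW e0)// (le_trans ler01).
    rewrite mulrA (_ : e / 2 * (2 / e) = 1); last by field; rewrite gt_eqF.
    rewrite mul1r expRN lnK ?posrE ?ltr0n// mulrAC -/(D k) mulrA ler_wpM2r ?invr_ge0//.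
    by rewrite -[leLHS]mulr1 ler_pM// exprn_ege1.
  have nln (n : nat) (x : R) : (0 < n)%N -> n%:R * (x / n%:R) = x.
    by move=> n0; rewrite mulrC divfK// pnatr_eq0 -lt0n.
  suff [C' [N' H]] : exists C' : R, exists N' : nat, forall n : nat, (N' <= n)%N ->
      ('E_P[Rn p (fun i => X i : T -> R) n] <= (C' * (ln n%:R ^+ 2 / n%:R))%:E)%E.
    by exists C', N' => n /H; rewrite mulrA.
  (* The constants [8 / e] and [1 / 4] come from [ln x < x] at [x = n ^ (1/4)], that is
     [ln n < 4 * n ^ (1/4)]. *)
  apply: (mean_Rn_rate iidX X0 p (fun n => ln n%:R ^+ 2 / n%:R) (fun n => 2 / e * ln n%:R) (fun n => 2 / e * ln n%:R)
    C (8 / e) (1 / 4) (truncn (expR 1 : R)).+1) => //.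
  + by rewrite divr_gt0.
  + lra.
  + move=> n hn n0; have l1 := ln1 n hn.
    have L0 : 0 < 2 / e * ln n%:R by rewrite mulr_gt0 ?divr_gt0// (lt_le_trans ltr01).
    split=> //.
    rewrite (_ : 8 / e = 2 / e * 4); last by field; rewrite gt_eqF.
    rewrite -[leRHS]mulrA ler_wpM2l ?divr_ge0 ?(ltW e0)//.
    have := ln_sublinear (powRn_gt0 (1 / 4) n n0); rewrite ln_powR; lra.
  + move=> n hn n0; apply: hE => //.
    by rewrite /C -!addrA lerDl !addr_ge0// sqr_ge0.
  + move=> n hn n0; apply: hE => //.
    by rewrite /C addrAC -addrA [D _ + _]addrC -!addrA lerDl !addr_ge0// sqr_ge0.
  + move=> n hn n0; rewrite nln// exprMn ler_wpM2r ?sqr_ge0//.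
    by rewrite /C addrAC lerDr !addr_ge0.
  + move=> n hn n0; rewrite nln//.
    rewrite mulr_ege1 ?exprn_ege1 ?ln1//.
    by rewrite /C lerDr !addr_ge0// sqr_ge0.
Qed.
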